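(* Define the polynomial $R_3(x)$, $x=(x_1,x_2,x_3)\in\mathbb{R}^3$, by $$R_3(x) = 72\,x_1x_2x_3 - 4(x_1+x_2+x_3) + 4(x_1+x_2+x_3)^2 - 8(x_1x_2+x_2x_3+x_1x_3) + 1 .$$ Then $72^{-1}R_3(x)$ is a polynomial of least deviation from zero and $$E_2(x_1x_2x_3;T^3) = E_2(x_1x_2(1-x_1-x_2);T^2) = 72^{-1}\|R_3\|_{C(T^3)} = 72^{-1}.$$ Furthermore, $72^{-2}R_3(x_1^2,x_2^2,x_3^2)$ is a polynomial of least deviation from zero and $$E_5(x_1^2x_2^2x_3^2;B^3) = E_5(x_1^2x_2^2x_3^2;S^2) = 72^{-2}\,\|R_3(x_1^2,x_2^2,x_3^2)\|_{C(B^3)} = 72^{-2}.$$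
   Context: $\Pi_n^d$ is the space of real polynomials of total degree at most $n$ in $d$ variables. For compact $\Omega\subset\mathbb{R}^d$, $\|f\|_{C(\Omega)}=\max_{x\in\Omega}|f(x)|$, and for $f\in C(\Omega)$ here $E_m(f;\Omega)=\inf_{p\in\Pi_m^d}\|f-p\|_{C(\Omega)}$ (for $\Omega = S^{d-1}$ the polynomials in $\Pi_m^d$ are restricted to the sphere). If $p^*\in\Pi^d_{|\alpha|-1}$ attains $\inf_{p\in\Pi^d_{|\alpha|-1}}\|x^\alpha-p\|_{C(\Omega)}$, then $x^\alpha-p^*(x)$ is called a polynomial of least deviation from zero (for the monomial $x^\alpha$ on $\Omega$). In the first part of the claim the monomial is $x_1x_2x_3$ on $T^3$; in the second part it is $x_1^2x_2^2x_3^2$ on $B^3$ and $S^2$. The domains are the unit ball $B^d=\{x\in\mathbb{R}^d:\|x\|\le 1\}$ (Euclidean norm), the unit sphere $S^{d-1}=\{x\in\mathbb{R}^d:\|x\|=1\}$, and the simplex $T^d=\{x\in\mathbb{R}^d: x_1\ge0,\ldots,x_d\ge0,\ 1-x_1-\cdots-x_d\ge0\}$.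
   Formalization: In the second part the factor 72^{-2} is replaced by 72^{-1} everywhere (normalization of R_3(x_1^2,x_2^2,x_3^2), factor before its norm, value of E_5), since its coefficient at x_1^2x_2^2x_3^2 is 72 and E_5 equals 1/72. *)

(* Defs.v *)
From HB Require Import structures.
From mathcomp Require Import all_boot all_order all_algebra.
From mathcomp Require Import classical_sets reals.
From mathcomp.multinomials Require Import mpoly.

Set Implicit Arguments.
Unset Strict Implicit.
Unset Printing Implicit Defensive.

Import Order.TTheory GRing.Theory Num.Theory.
Local Open Scope classical_set_scope.
Local Open Scope ring_scope.

(* MathComp-Analysis equips 'rV[R]_d with the max norm, so the Euclidean norm
   is introduced here. *)
Definition enorm (R : realType) (d : nat) (x : 'rV[R]_d) : R :=
  Num.sqrt (\sum_(i < d) x 0 i ^+ 2).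

Definition unit_ball (R : realType) (d : nat) : set 'rV[R]_d :=
  [set x | enorm x <= 1].

(* Indexed by the dimension of the ambient space: this is S^(d-1). *)
Definition unit_sphere (R : realType) (d : nat) : set 'rV[R]_d :=
  [set x | enorm x = 1].

Definition simplex (R : realType) (d : nat) : set 'rV[R]_d :=
  [set x | (forall i, 0 <= x 0 i) /\ 0 <= 1 - \sum_(i < d) x 0 i].

Definition mpoly_fun (R : realType) (d : nat) (p : {mpoly R[d]}) :
    'rV[R]_d -> R :=
  fun x => p.@[x 0].

(* The supremum is a maximum when f is continuous and Omega is compact and
   nonempty, the only case in which this is used. *)
Definition supnorm (R : realType) (d : nat) (Omega : set 'rV[R]_d)
    (f : 'rV[R]_d -> R) : R :=
  sup [set `|f x| | x in Omega].

(* msize is one more than the total degree (and 0 for the zero polynomial). *)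
Definition poly_le (R : realType) (d n : nat) : set {mpoly R[d]} :=
  [set p | (msize p <= n.+1)%N].

Definition best_approx (R : realType) (d n : nat) (Omega : set 'rV[R]_d)
    (f : 'rV[R]_d -> R) : R :=
  inf [set supnorm Omega (fun x => f x - mpoly_fun p x)
      | p in @poly_le R d n].

Definition least_deviation (R : realType) (d : nat) (a : 'X_{1..d})
    (Omega : set 'rV[R]_d) (q : {mpoly R[d]}) : Prop :=
  exists p : {mpoly R[d]},
    [/\ @poly_le R d (mdeg a).-1 p,
        supnorm Omega (fun x => mpoly_fun 'X_[a] x - mpoly_fun p x) =
          best_approx (mdeg a).-1 Omega (mpoly_fun 'X_[a])
      & q = 'X_[a] - p].

Definition R3 (R : realType) : {mpoly R[3]} :=
  let x1 : {mpoly R[3]} := 'X_0 in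
  let x2 : {mpoly R[3]} := 'X_1 in
  let x3 : {mpoly R[3]} := 'X_2 in
  72 * x1 * x2 * x3 - 4 * (x1 + x2 + x3) + 4 * (x1 + x2 + x3) ^+ 2
    - 8 * (x1 * x2 + x2 * x3 + x1 * x3) + 1.

(* R_3(x_1^2, x_2^2, x_3^2).  Its coefficient at x_1^2 x_2^2 x_3^2 is 72, so
   the associated polynomial x_1^2 x_2^2 x_3^2 - p is 72^-1 times it; the
   factor 72^-2 printed in the source for this polynomial and for its
   deviation is a misprint. *)
Definition R3_squares (R : realType) : {mpoly R[3]} :=
  R3 R \mPo [tuple 'X_i ^+ 2 | i < 3].

(* Main.v *)
Require Import Defs.
From HB Require Import structures.
From mathcomp Require Import all_boot all_order all_algebra.
From mathcomp Require Import boolp classical_sets reals.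
From mathcomp.multinomials Require Import mpoly.
From mathcomp Require Import ring lra zify.

Set Implicit Arguments.
Unset Strict Implicit.
Unset Printing Implicit Defensive.

Import Order.TTheory GRing.Theory Num.Theory.
Local Open Scope classical_set_scope.
Local Open Scope ring_scope.

(** The argument is the classical duality for best uniform approximation.
Suppose that a finite combination L of point evaluations at points t_i of
Omega, with weights w_i, vanishes on the polynomials of degree at most n, and
that p0 is such a polynomial whose error f - p0 is bounded by M on Omega and
equals M times the sign of w_i at t_i.  For any competitor p,
  M (sum |w_i|) = L(f - p0) = L(f - p) <= (sum |w_i|) ||f - p||,
so p0 is optimal and the distance is M ([best_approx_signature]).

For x1 x2 x3 on the solid simplex the t_i are the barycenters of the seven
nonempty faces of the triangle x1 + x2 + x3 = 1, a face with k vertices having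
weight (-1)^(k-1) k^2: weight 1 at the vertices, -4 at the midpoints of the
edges and 9 at the center.  These weights kill the quadratic polynomials
([barycenter_monomials]), and R_3 takes the values 1, -1, 1 there
([barycenter_R3_val]).  The bound |R_3| <= 1 on the simplex follows from
Schur's inequality on one side and from e1 e2 >= 9 e3 on the other
([R3_val_le1]).  Since all seven points lie on the face x1 + x2 + x3 = 1,
which projects bijectively onto the simplex in two variables, they also
certify the claim about x1 x2 (1 - x1 - x2).

For the ball and the sphere, x |-> (x1^2, x2^2, x3^2) maps the ball into the
simplex.  Giving the weight w_i to every signed square root of t_i defines a
combination of evaluations on the unit sphere.  The resulting functional kills
every monomial with an odd exponent, and on a monomial with even exponents it
is a multiple of the original functional at half the exponents.  Degree n on
the simplex thus becomes degree 2 n + 1 ([annihilates_signed_root]), which is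
how degree 2 turns into degree 5, and the certificate applies to every set
between the sphere and the ball ([best_approx_squares]). *)

(** * Duality for best uniform approximation *)

Lemma supnorm_attained (R : realType) (d : nat) (Omega : set 'rV[R]_d)
    (f : 'rV[R]_d -> R) (M : R) (x : 'rV[R]_d) :
  Omega x -> `|f x| = M -> (forall y, Omega y -> `|f y| <= M) ->
  supnorm Omega f = M.
Proof.
move=> Ox fx fM; have ubM : ubound [set `|f y| | y in Omega] M.
  by move=> _ [y Oy <-]; apply: fM.
apply/eqP; rewrite eq_le; apply/andP; split.
  by apply: ge_sup => //; exists `|f x|, x.
by apply: ub_le_sup; [exists M | exists x].
Qed.

(** The bound on f matters: [sup] of an unbounded set is a default value, so
without it the supremum need not dominate anything. *)
Lemma le_supnorm (R : realType) (d : nat) (Omega : set 'rV[R]_d)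
    (f : 'rV[R]_d -> R) (B : R) (x : 'rV[R]_d) :
  (forall y, Omega y -> `|f y| <= B) -> Omega x -> `|f x| <= supnorm Omega f.
Proof.
move=> fB Ox; apply: ub_le_sup; last by exists x.
by exists B => _ [y Oy <-]; apply: fB.
Qed.

Lemma best_approx_attained (R : realType) (d n : nat) (Omega : set 'rV[R]_d)
    (f : 'rV[R]_d -> R) (p0 : {mpoly R[d]}) (M : R) :
  @poly_le R d n p0 -> supnorm Omega (fun x => f x - mpoly_fun p0 x) = M ->
  (forall p, @poly_le R d n p ->
     M <= supnorm Omega (fun x => f x - mpoly_fun p x)) ->
  best_approx n Omega f = M.
Proof.
move=> p0n fp0 lbM.
have lb : lbound [set supnorm Omega (fun x => f x - mpoly_fun p x)
                 | p in @poly_le R d n] M.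
  by move=> _ [p pn <-]; apply: lbM.
apply/eqP; rewrite eq_le; apply/andP; split.
  by apply: ge_inf; [exists M | exists p0].
by apply: lb_le_inf => //; exists M, p0.
Qed.

(** A form of boundedness under which every monomial is at most 1 in absolute
value, so that a polynomial is bounded by the sum of its coefficients. *)
Definition in_cube (R : realType) (d : nat) (Omega : set 'rV[R]_d) : Prop :=
  forall x, Omega x -> forall i, `|x 0 i| <= 1.

Lemma mpoly_fun_bounded (R : realType) (d : nat) (Omega : set 'rV[R]_d)
    (p : {mpoly R[d]}) :
  in_cube Omega ->
  exists B : R, forall x, Omega x -> `|mpoly_fun p x| <= B.
Proof.
move=> cube; exists (\sum_(m <- msupp p) `|p@_m|) => x Ox.
rewrite /mpoly_fun mevalE; apply: le_trans (ler_norm_sum _ _ _) _.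
apply: ler_sum => m _; rewrite normrM ler_piMr // normr_prod.
apply: prodr_ile1 => i _.
by rewrite normr_ge0 normrX exprn_ile1 ?cube.
Qed.

Definition annihilates (R : realType) (d n : nat) (I : finType) (w : I -> R)
    (t : I -> 'rV[R]_d) : Prop :=
  forall p, @poly_le R d n p -> \sum_i w i * mpoly_fun p (t i) = 0.

(** The points t_i where the error r reaches its bound M with the sign of w_i.
The sign condition is multiplied out by w_i so as to say nothing where the
weight vanishes. *)
Definition extremal_signature (R : realType) (d n : nat) (Omega : set 'rV[R]_d)
    (I : finType) (w : I -> R) (t : I -> 'rV[R]_d) (r : 'rV[R]_d -> R) (M : R)
    : Prop :=
  [/\ annihilates n w t, forall i, Omega (t i), exists i, w i != 0
    & forall i, w i * r (t i) = `|w i| * M].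

(** Applying the annihilating functional to f - p0 and to f - p gives the same
value, which is as large as the weights allow for f - p0. *)
Lemma best_approx_signature (R : realType) (d n : nat) (Omega : set 'rV[R]_d)
    (I : finType) (w : I -> R) (t : I -> 'rV[R]_d) (f : 'rV[R]_d -> R)
    (p0 : {mpoly R[d]}) (M : R) :
  in_cube Omega -> @poly_le R d n p0 ->
  (forall x, Omega x -> `|f x - mpoly_fun p0 x| <= M) ->
  extremal_signature n Omega w t (fun x => f x - mpoly_fun p0 x) M ->
  supnorm Omega (fun x => f x - mpoly_fun p0 x) = M /\
  best_approx n Omega f = M.
Proof.
move=> cube p0n leM [ann Ot [i0 wi0] sgn].
have M0 : 0 <= M by apply: le_trans (leM _ (Ot i0)).
have sup0 : supnorm Omega (fun x => f x - mpoly_fun p0 x) = M.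
  apply: (@supnorm_attained _ _ _ _ _ (t i0)) => //.
  have /(congr1 Num.norm) := sgn i0.
  by rewrite !normrM normr_id (ger0_norm M0); apply: mulfI; rewrite normr_eq0.
split=> //; apply: best_approx_attained sup0 _ => // p pn.
have [B0 pB0] := mpoly_fun_bounded p0 cube.
have [B pB] := mpoly_fun_bounded p cube.
set S := supnorm _ _.
have leS x : Omega x -> `|f x - mpoly_fun p x| <= S.
  apply: (@le_supnorm _ _ _ _ (M + (B0 + B))) => y Oy.
  have -> : f y - mpoly_fun p y =
      (f y - mpoly_fun p0 y) + (mpoly_fun p0 y - mpoly_fun p y) by ring.
  apply: le_trans (ler_normD _ _) _; apply: lerD; first exact: leM.
  by apply: le_trans (ler_normB _ _) _; apply: lerD; [apply: pB0 | apply: pB].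
have W0 : 0 < \sum_i `|w i|.
  rewrite (bigD1 i0) //= ltr_pwDl ?normr_gt0 //.
  by apply: sumr_ge0 => i _.
have eqM : (\sum_i `|w i|) * M = \sum_i w i * (f (t i) - mpoly_fun p (t i)).
  rewrite mulr_suml -(eq_bigr _ (fun i _ => sgn i)).
  under eq_bigr do rewrite mulrBr.
  under [RHS]eq_bigr do rewrite mulrBr.
  by rewrite !sumrB (ann _ p0n) (ann _ pn).
rewrite -(ler_pM2l W0) eqM mulr_suml; apply: ler_sum => i _.
apply: le_trans (ler_norm _) _; rewrite normrM.
by rewrite ler_wpM2l // leS.
Qed.

Lemma least_deviation_of (R : realType) (d : nat) (a : 'X_{1..d})
    (Omega : set 'rV[R]_d) (p : {mpoly R[d]}) (M : R) :
  @poly_le R d (mdeg a).-1 p ->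
  supnorm Omega (fun x => mpoly_fun 'X_[a] x - mpoly_fun p x) = M /\
  best_approx (mdeg a).-1 Omega (mpoly_fun 'X_[a]) = M ->
  least_deviation a Omega ('X_[a] - p).
Proof. by move=> pn [supM bestM]; exists p; rewrite supM bestM. Qed.

Lemma annihilates_monomials (R : realType) (d n : nat) (I : finType)
    (w : I -> R) (t : I -> 'rV[R]_d) :
  (forall m : 'X_{1..d}, (mdeg m <= n)%N ->
     \sum_i w i * \prod_j t i 0 j ^+ m j = 0) ->
  annihilates n w t.
Proof.
move=> mono p pn; rewrite /mpoly_fun.
under eq_bigr do rewrite mevalE mulr_sumr.
rewrite exchange_big /= big_seq big1 // => m mp.
under eq_bigr do rewrite mulrCA.
by rewrite -mulr_sumr mono ?mulr0 // -ltnS (leq_trans (msize_mdeg_lt mp)).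
Qed.

Lemma mpoly_funX (R : realType) (d : nat) (x : 'rV[R]_d) (m : 'X_{1..d}) :
  mpoly_fun 'X_[m] x = \prod_j x 0 j ^+ m j.
Proof. exact: mevalX. Qed.

(** * Degree bounds *)

Lemma poly_leD (R : realType) (d n : nat) (p q : {mpoly R[d]}) :
  @poly_le R d n p -> @poly_le R d n q -> @poly_le R d n (p + q).
Proof.
by move=> pn qn; apply: leq_trans (mmeasureD_le _ _ _) _; rewrite geq_max pn.
Qed.

Lemma poly_leB (R : realType) (d n : nat) (p q : {mpoly R[d]}) :
  @poly_le R d n p -> @poly_le R d n q -> @poly_le R d n (p - q).
Proof.
by move=> pn qn; apply: poly_leD => //; rewrite /poly_le /= mmeasureN.
Qed.

Lemma poly_leM (R : realType) (d m n : nat) (p q : {mpoly R[d]}) :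
  @poly_le R d m p -> @poly_le R d n q -> @poly_le R d (m + n) (p * q).
Proof.
rewrite /poly_le /= => pm qn.
have [->|p0] := eqVneq p 0; first by rewrite mul0r msize0.
have [->|q0] := eqVneq q 0; first by rewrite mulr0 msize0.
by rewrite msizeM // -subn1 leq_subLR add1n -addSn -addnS; apply: leq_add.
Qed.

Lemma poly_leZ (R : realType) (d n : nat) (c : R) (p : {mpoly R[d]}) :
  @poly_le R d n p -> @poly_le R d n (c *: p).
Proof. by move=> pn; apply: leq_trans (msizeZ_le _ _) _. Qed.

Lemma poly_le_nat (R : realType) (d n k : nat) :
  @poly_le R d n (k%:R : {mpoly R[d]}).
Proof.
by rewrite /poly_le /= -mpolyC_nat mmeasureC; case: (_ != 0).
Qed.

Lemma poly_le1 (R : realType) (d n : nat) :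
  @poly_le R d n (1 : {mpoly R[d]}).
Proof. by rewrite -[1]mulr1n; apply: poly_le_nat. Qed.

Lemma poly_leX (R : realType) (d : nat) (i : 'I_d) :
  @poly_le R d 1 ('X_i : {mpoly R[d]}).
Proof. by rewrite /poly_le /= msizeX mdeg1. Qed.

(** * The substitution of squares *)

Definition squares (R : realType) (d : nat) (x : 'rV[R]_d) : 'rV[R]_d :=
  \row_j x 0 j ^+ 2.

Definition signed_root (R : realType) (d : nat) (s : {ffun 'I_d -> bool})
    (t : 'rV[R]_d) : 'rV[R]_d :=
  \row_j ((-1) ^+ s j * Num.sqrt (t 0 j)).

Lemma squares_signed_root (R : realType) (d : nat) (s : {ffun 'I_d -> bool})
    (t : 'rV[R]_d) :
  (forall j, 0 <= t 0 j) -> squares (signed_root s t) = t.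
Proof.
move=> t0; apply/rowP => j.
rewrite !mxE exprMn sqr_sqrtr // -exprM mulnC exprM sqrrN.
by rewrite expr1n expr1n mul1r.
Qed.

(** The sum over sign patterns is a product of sums over one sign each, and
(-1)^m + 1 is 0 or 2 according to the parity of m. *)
Lemma sum_signed_root (R : realType) (d : nat) (t : 'rV[R]_d)
    (m : 'X_{1..d}) :
  (forall j, 0 <= t 0 j) ->
  \sum_s \prod_j signed_root s t 0 j ^+ m j =
  \prod_j if odd (m j) then 0 else 2 * t 0 j ^+ (m j)./2.
Proof.
move=> t0.
pose F j (b : bool) := ((-1) ^+ b * Num.sqrt (t 0 j)) ^+ m j.
transitivity (\prod_j \sum_b F j b).
  rewrite bigA_distr_bigA; apply: eq_bigr => s _.
  by apply: eq_bigr => j _; rewrite mxE.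
apply: eq_bigr => j _.
rewrite big_bool /F /= expr1 expr0 mul1r mulN1r exprNn.
rewrite -[X in _ + X]mul1r -mulrDl.
rewrite -signr_odd -[m j in X in _ * X]odd_double_half.
case: (odd (m j)) => /=; first by rewrite expr1 addNr mul0r.
by rewrite expr0 -mul2n exprM sqr_sqrtr.
Qed.

(** Halving the exponents of an even monomial of degree at most 2 n + 1 gives a
monomial of degree at most n. *)
Lemma annihilates_signed_root (R : realType) (d n : nat) (I : finType)
    (w : I -> R) (t : I -> 'rV[R]_d) :
  (forall i j, 0 <= t i 0 j) -> annihilates n w t ->
  annihilates n.*2.+1 (fun k : {ffun 'I_d -> bool} * I => w k.2)
    (fun k => signed_root k.1 (t k.2)).
Proof.
move=> t0 ann; apply: annihilates_monomials => m mn.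
rewrite -(pair_bigA _
  (fun s i => w i * \prod_j signed_root s (t i) 0 j ^+ m j)).
rewrite exchange_big /=.
under eq_bigr => i _ do rewrite -mulr_sumr sum_signed_root //.
have [/existsP[j oddj]|/existsPn even] := boolP [exists j, odd (m j)].
  by rewrite big1 // => i _; rewrite (bigD1 j) //= oddj mul0r mulr0.
pose h : 'X_{1..d} := [multinom (m j)./2 | j < d].
have hn : (mdeg h <= n)%N.
  suff : ((mdeg h).*2 <= n.*2.+1)%N by lia.
  apply: leq_trans mn; rewrite !mdegE -mul2n big_distrr /=.
  by apply: leq_sum => j _; rewrite mnmE mul2n halfK leq_subr.
have := ann 'X_[h]; rewrite /poly_le /= msizeX ltnS => /(_ hn) sum0.
transitivity (\sum_i 2 ^+ d * (w i * mpoly_fun 'X_[h] (t i))); last first.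
  by rewrite -mulr_sumr sum0 mulr0.
apply: eq_bigr => i _; rewrite mpoly_funX mulrCA; congr (_ * _).
under eq_bigr => j _ do rewrite (negbTE (even j)).
rewrite big_split /= prodr_const card_ord; congr (_ * _).
by apply: eq_bigr => j _; rewrite mnmE.
Qed.

Definition squares_mpoly (R : realType) (d : nat) (p : {mpoly R[d]}) :
    {mpoly R[d]} :=
  p \mPo [tuple 'X_i ^+ 2 | i < d].

Lemma mpoly_fun_squares (R : realType) (d : nat) (p : {mpoly R[d]}) x :
  mpoly_fun (squares_mpoly p) x = mpoly_fun p (squares x).
Proof.
rewrite /mpoly_fun /squares_mpoly comp_mpoly_meval; apply: meval_eq => j.
by rewrite tnth_mktuple !mxE rmorphXn /= mevalXU.
Qed.

Lemma squares_mpolyX (R : realType) (d : nat) (m : 'X_{1..d}) :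
  squares_mpoly ('X_[m] : {mpoly R[d]}) = 'X_[m *+ 2].
Proof.
rewrite /squares_mpoly comp_mpolyX [RHS]mpolyXE_id.
apply: eq_bigr => j _; rewrite tnth_mktuple mulmnE -exprM mulnC //.
Qed.

Lemma squares_mpoly_le (R : realType) (d n : nat) (p : {mpoly R[d]}) :
  @poly_le R d n p -> @poly_le R d n.*2.+1 (squares_mpoly p).
Proof.
rewrite /poly_le /= => pn; rewrite /squares_mpoly comp_mpolyEX.
apply: leq_trans (msize_sum _ _ _) _; apply/bigmax_leqP_seq => m mp _.
apply: leq_trans (msizeZ_le _ _) _.
rewrite -/(squares_mpoly _) squares_mpolyX msizeX mdegMn.
have := leq_trans (msize_mdeg_lt mp) pn; lia.
Qed.
(** * Simplex, ball and sphere *)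

Lemma simplex_in_cube (R : realType) (d : nat) : in_cube (@simplex R d).
Proof.
move=> x [x0 x1] i; rewrite ger0_norm //;
  apply: le_trans (_ : _ <= \sum_j x 0 j) _.
  by rewrite (bigD1 i) //= lerDl sumr_ge0.
by rewrite -subr_ge0.
Qed.

Lemma enorm_le1 (R : realType) (d : nat) (x : 'rV[R]_d) :
  (enorm x <= 1) = (\sum_i x 0 i ^+ 2 <= 1).
Proof. by rewrite /enorm -[X in _ <= X]sqrtr1 ler_sqrt. Qed.

Lemma simplex_squares (R : realType) (d : nat) (x : 'rV[R]_d) :
  @unit_ball R d x -> @simplex R d (squares x).
Proof.
rewrite /unit_ball /= enorm_le1 => x1; split=> [i|].
  by rewrite mxE sqr_ge0.
by rewrite subr_ge0; under eq_bigr do rewrite mxE.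
Qed.

Lemma unit_ball_in_cube (R : realType) (d : nat) : in_cube (@unit_ball R d).
Proof.
move=> x /simplex_squares/simplex_in_cube xi i; have := xi i.
by rewrite mxE normrX expr_le1.
Qed.

Lemma unit_sphere_signed_root (R : realType) (d : nat)
    (s : {ffun 'I_d -> bool}) (t : 'rV[R]_d) :
  (forall j, 0 <= t 0 j) -> \sum_j t 0 j = 1 ->
  @unit_sphere R d (signed_root s t).
Proof.
move=> t0 t1; rewrite /unit_sphere /= /enorm.
have -> : \sum_j signed_root s t 0 j ^+ 2 = 1; last by rewrite sqrtr1.
rewrite -t1 -[in RHS](squares_signed_root s t0).
by apply: eq_bigr => j _; rewrite [RHS]mxE.
Qed.

(** The certificate of f on the simplex, pulled back along squaring.  The
evaluation points must lie on the face where the coordinates sum to 1, so that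
their signed square roots lie on the sphere. *)
Lemma best_approx_squares (R : realType) (d n : nat) (Omega : set 'rV[R]_d)
    (I : finType) (w : I -> R) (t : I -> 'rV[R]_d) (f : 'rV[R]_d -> R)
    (p0 : {mpoly R[d]}) (M : R) :
  @unit_sphere R d `<=` Omega -> Omega `<=` @unit_ball R d ->
  @poly_le R d n p0 ->
  (forall x, @simplex R d x -> `|f x - mpoly_fun p0 x| <= M) ->
  extremal_signature n (@simplex R d) w t (fun x => f x - mpoly_fun p0 x) M ->
  (forall i, \sum_j t i 0 j = 1) ->
  supnorm Omega
    (fun x => f (squares x) - mpoly_fun (squares_mpoly p0) x) = M /\
  best_approx n.*2.+1 Omega (fun x => f (squares x)) = M.
Proof.
move=> sphO Oball p0n leM [ann simp_t [i0 wi0] sgn] t1.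
have t0 i j : 0 <= t i 0 j by case: (simp_t i).
apply: (@best_approx_signature _ _ _ _ _
  (fun k : {ffun 'I_d -> bool} * I => w k.2)
  (fun k => signed_root k.1 (t k.2))).
- by move=> x /Oball; apply: unit_ball_in_cube.
- exact: squares_mpoly_le.
- by move=> x /Oball/simplex_squares; rewrite mpoly_fun_squares; apply: leM.
split.
- exact: annihilates_signed_root.
- by move=> [s i]; apply/sphO/unit_sphere_signed_root.
- by exists ([ffun=> false], i0).
- by move=> [s i]; rewrite mpoly_fun_squares squares_signed_root ?sgn.
Qed.

(** * The bound on R_3 over the simplex *)

(** All but the ordered case follow by symmetry; with a >= b >= c the sum is
(a - b)^2 (a + b - c) + c (a - c) (b - c). *)
Lemma schur_inequality (R : realDomainType) (x y z : R) :
  0 <= x -> 0 <= y -> 0 <= z ->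
  0 <= x * (x - y) * (x - z) + y * (y - x) * (y - z) + z * (z - x) * (z - y).
Proof.
have ordered (a b c : R) : 0 <= c -> c <= b -> b <= a ->
    0 <= a * (a - b) * (a - c) + b * (b - a) * (b - c) + c * (c - a) * (c - b).
  move=> c0 cb ba.
  have -> : a * (a - b) * (a - c) + b * (b - a) * (b - c)
            + c * (c - a) * (c - b)
          = (a - b) ^+ 2 * (a + (b - c)) + c * ((a - c) * (b - c)) by ring.
  have ca := le_trans cb ba; have a0 := le_trans c0 ca.
  apply: addr_ge0; last by rewrite !mulr_ge0 ?subr_ge0.
  by rewrite mulr_ge0 ?sqr_ge0 // ler_wpDl ?subr_ge0.
move=> x0 y0 z0.
have [xy|/ltW yx] := leP x y; have [yz|/ltW zy] := leP y z;
  have [xz|/ltW zx] := leP x z.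
- by have := ordered z y x x0 xy yz; lra.
- by have := ordered z y x x0 xy yz; lra.
- by have := ordered y z x x0 xz zy; lra.
- by have := ordered y x z z0 zx xy; lra.
- by have := ordered z x y y0 yx xz; lra.
- by have := ordered x z y y0 yz zx; lra.
- by have := ordered x y z z0 zy yx; lra.
- by have := ordered x y z z0 zy yx; lra.
Qed.

Definition R3_val (R : realType) (a b c : R) : R :=
  72 * a * b * c - 4 * (a + b + c) + 4 * (a + b + c) ^+ 2
  - 8 * (a * b + b * c + a * c) + 1.

(** Write s, e2, e3 for the elementary symmetric functions.  For the lower
bound,
  s (R_3 + 1) = 2 (s (1 - s)^2 + (s^3 - 4 s e2 + 9 e3) + 9 e3 (4 s - 1)),
whose middle term is Schur's.  The last term has the wrong sign for s < 1/4,
but there e2 <= s^2 / 3 is enough.  For the upper bound,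
  1 - R_3 = 4 s (1 - s) + 8 e2 (1 - s) + 8 (s e2 - 9 e3). *)
Lemma R3_val_le1 (R : realType) (a b c : R) :
  0 <= a -> 0 <= b -> 0 <= c -> a + b + c <= 1 -> `|R3_val a b c| <= 1.
Proof.
move=> a0 b0 c0 s1; rewrite ler_norml; apply/andP; split.
  have sch := schur_inequality a0 b0 c0.
  have abc0 : 0 <= a * b * c by rewrite !mulr_ge0.
  rewrite -subr_ge0 /R3_val.
  set s := a + b + c in s1 *; set e2 := a * b + b * c + a * c.
  have {}sch : 0 <= s ^+ 3 - 4 * s * e2 + 9 * (a * b * c).
    by apply: le_trans sch _; rewrite /s /e2; lra.
  have [s_small|s_large] := ltP s 4^-1.
    have e2s : 3 * e2 <= s ^+ 2.
      have := sqr_ge0 (a - b); have := sqr_ge0 (b - c); have := sqr_ge0 (a - c).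
      rewrite /s /e2; lra.
    nra.
  have s0 : 0 < s by lra.
  rewrite -(pmulr_rge0 _ s0).
  have : 0 <= s * (1 - s) ^+ 2 by rewrite mulr_ge0 ?sqr_ge0 ?ltW.
  have : 0 <= (4 * s - 1) * (a * b * c) by rewrite mulr_ge0 //; lra.
  lra.
(* The sum below is s e2 - 9 e3. *)
have : 0 <= a * (b - c) ^+ 2 + b * (a - c) ^+ 2 + c * (a - b) ^+ 2.
  by rewrite !addr_ge0 // mulr_ge0 ?sqr_ge0.
have : 0 <= (1 - (a + b + c)) * (a * b + b * c + a * c).
  by rewrite mulr_ge0 ?subr_ge0 // !addr_ge0 // mulr_ge0.
have : 0 <= (1 - (a + b + c)) * (a + b + c).
  by rewrite mulr_ge0 ?subr_ge0 // !addr_ge0.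
rewrite /R3_val; lra.
Qed.

Lemma scaled_R3_val_le (R : realType) (a b c : R) :
  0 <= a -> 0 <= b -> 0 <= c -> a + b + c <= 1 ->
  `|72^-1 * R3_val a b c| <= 72^-1.
Proof.
move=> a0 b0 c0 s1; rewrite normrM ger0_norm ?invr_ge0 ?ler0n //.
by rewrite ler_piMr ?invr_ge0 ?ler0n // R3_val_le1.
Qed.

(** * Barycenters of the faces *)

Lemma sum_ord2 (V : nmodType) (F : 'I_2 -> V) : \sum_j F j = F 0 + F 1.
Proof.
rewrite !big_ord_recl big_ord0 addr0.
by congr (_ + F _); apply: val_inj.
Qed.

Lemma prod_ord2 (R : comNzRingType) (F : 'I_2 -> R) : \prod_j F j = F 0 * F 1.
Proof.
rewrite !big_ord_recl big_ord0 mulr1.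
by congr (_ * F _); apply: val_inj.
Qed.

Lemma sum_ord3 (V : nmodType) (F : 'I_3 -> V) :
  \sum_j F j = F 0 + F 1 + F 2.
Proof.
rewrite !big_ord_recl big_ord0 addr0 addrA.
by congr (_ + F _ + F _); apply: val_inj.
Qed.

Lemma prod_ord3 (R : comNzRingType) (F : 'I_3 -> R) :
  \prod_j F j = F 0 * F 1 * F 2.
Proof.
rewrite !big_ord_recl big_ord0 mulr1 mulrA.
by congr (_ * F _ * F _); apply: val_inj.
Qed.

Definition barycenter_weight (R : realType) (k : 'I_7) : R :=
  [:: 1; 1; 1; - 4; - 4; - 4; 9]`_k.

(** Barycenters of the faces spanned by the standard basis: vertices, then
edges, then the whole triangle. *)
Definition barycenter_coords (R : realType) (k : 'I_7) : seq R :=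
  nth [::] [:: [:: 1; 0; 0]; [:: 0; 1; 0]; [:: 0; 0; 1];
      [:: 2^-1; 2^-1; 0]; [:: 0; 2^-1; 2^-1]; [:: 2^-1; 0; 2^-1];
      [:: 3^-1; 3^-1; 3^-1]] k.

(** For d = 3 the barycenters themselves; for d = 2 their projections onto the
first two coordinates. *)
Definition barycenter (R : realType) (d : nat) (k : 'I_7) : 'rV[R]_d :=
  \row_j (barycenter_coords R k)`_j.

(** Stated with three exponents because c = 0 gives the same fact for the
projected points. *)
Lemma barycenter_monomials (R : realType) (a b c : nat) : (a + b + c <= 2)%N ->
  \sum_k barycenter_weight R k *
    (barycenter R 3 k 0 0 ^+ a * barycenter R 3 k 0 1 ^+ b
     * barycenter R 3 k 0 2 ^+ c) = 0.
Proof.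
move=> abc; rewrite !big_ord_recl big_ord0 !mxE.
rewrite /barycenter_weight /barycenter_coords /=.
by case: a b c abc => [|[|[|a]]] [|[|[|b]]] [|[|[|c]]] // _;
  rewrite ?expr0 ?expr1 ?expr1n ?expr0n /=; field.
Qed.

Lemma barycenter_ge0 (R : realType) (k : 'I_7) j : 0 <= barycenter R 3 k 0 j.
Proof.
rewrite mxE /barycenter_coords.
by case: k j => [[|[|[|[|[|[|[|k]]]]]]] hk] [[|[|[|j]]] hj] //=;
  rewrite ?invr_ge0 ?ler01 ?ler0n.
Qed.

Lemma sum_barycenter (R : realType) (k : 'I_7) :
  \sum_j barycenter R 3 k 0 j = 1.
Proof.
rewrite sum_ord3 !mxE /barycenter_coords.
by case: k => [[|[|[|[|[|[|[|k]]]]]]] hk] //=; field.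
Qed.

Lemma barycenter_R3_val (R : realType) (k : 'I_7) :
  barycenter_weight R k *
    R3_val (barycenter R 3 k 0 0) (barycenter R 3 k 0 1)
      (barycenter R 3 k 0 2) =
  `|barycenter_weight R k|.
Proof.
rewrite !mxE /barycenter_weight /barycenter_coords /R3_val.
by case: k => [[|[|[|[|[|[|[|k]]]]]]] hk] //=;
  rewrite ?normrN ger0_norm ?ler0n //; field.
Qed.
Lemma barycenter_in_simplex (R : realType) (k : 'I_7) :
  @simplex R 3 (barycenter R 3 k).
Proof.
by split=> [j|]; [apply: barycenter_ge0 | rewrite sum_barycenter subrr].
Qed.

Lemma barycenter_annihilates (R : realType) :
  annihilates 2 (@barycenter_weight R) (barycenter R 3).
Proof.
apply: annihilates_monomials => m; rewrite mdegE sum_ord3 => m2.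
by under eq_bigr do rewrite prod_ord3; apply: barycenter_monomials.
Qed.

Lemma barycenter_weight_neq0 (R : realType) :
  exists k, barycenter_weight R k != 0.
Proof. by exists ord0; rewrite /barycenter_weight /= oner_eq0. Qed.

Lemma barycenter_sign (R : realType) (k : 'I_7) :
  barycenter_weight R k * (72^-1 *
    R3_val (barycenter R 3 k 0 0) (barycenter R 3 k 0 1)
      (barycenter R 3 k 0 2)) =
  `|barycenter_weight R k| * 72^-1.
Proof. by rewrite mulrCA barycenter_R3_val mulrC. Qed.

(** * R_3 as an approximation error *)

(** The part of degree at most 2 of R_3, with the sign changed: 1/72 of it is
the best approximation of x1 x2 x3. *)
Definition R3_low (R : realType) : {mpoly R[3]} :=
  4 * ('X_0 + 'X_1 + 'X_2) - 4 * ('X_0 + 'X_1 + 'X_2) ^+ 2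
  + 8 * ('X_0 * 'X_1 + 'X_1 * 'X_2 + 'X_0 * 'X_2) - 1.

Lemma R3_low_le (R : realType) : @poly_le R 3 2 (R3_low R).
Proof.
have N (k n : nat) := @poly_le_nat R 3 n k.
have X := @poly_leX R 3.
rewrite /R3_low.
apply: poly_leB; last exact: poly_le1.
have XX i j : @poly_le R 3 2 ('X_i * 'X_j) by apply: (@poly_leM _ _ 1 1).
have e1 : @poly_le R 3 1 ('X_0 + 'X_1 + 'X_2).
  by apply: poly_leD => //; apply: poly_leD.
apply: poly_leD; [apply: poly_leB|].
- by apply: (@poly_leM _ _ 1 1).
- by apply: (@poly_leM _ _ 0 2) => //; apply: (@poly_leM _ _ 1 1).
by apply: (@poly_leM _ _ 0 2) => //; apply: poly_leD => //; apply: poly_leD.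
Qed.

(** [R3_low] restricted to the face x1 + x2 + x3 = 1, which is parametrized by
its first two coordinates. *)
Definition face_low (R : realType) : {mpoly R[2]} :=
  8 * ('X_0 * 'X_1 + ('X_0 + 'X_1) * (1 - 'X_0 - 'X_1)) - 1.

Lemma face_low_le (R : realType) : @poly_le R 2 2 (face_low R).
Proof.
have N (k n : nat) := @poly_le_nat R 2 n k.
have X := @poly_leX R 2.
apply: poly_leB; last exact: poly_le1.
apply: (@poly_leM _ _ 0 2) => //.
apply: poly_leD; apply: (@poly_leM _ _ 1 1) => //.
  by apply: poly_leD.
by do 2!apply: poly_leB => //; apply: poly_le1.
Qed.

Lemma R3_split (R : realType) :
  72^-1 *: R3 R = 'X_[[multinom 1%N | i < 3]] - 72^-1 *: R3_low R.
Proof.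
have -> : R3 R = 72%:R%:MP * 'X_[[multinom 1%N | i < 3]] - R3_low R.
  rewrite mpolyXE_id prod_ord3 !mnmE mpolyC_nat /R3 /R3_low; ring.
by rewrite scalerBr mul_mpolyC scalerA mulVf ?scale1r // pnatr_eq0.
Qed.

Lemma mpoly_fun_R3 (R : realType) (x : 'rV[R]_3) :
  mpoly_fun (R3 R) x = R3_val (x 0 0) (x 0 1) (x 0 2).
Proof.
by rewrite /mpoly_fun /R3 !(mevalD, mevalN, mevalM, rmorphXn, rmorph_nat,
  mevalXU, meval1, mevalB).
Qed.

Lemma monomial_approx_error (R : realType) (x : 'rV[R]_3) :
  mpoly_fun 'X_[[multinom 1%N | i < 3]] x - mpoly_fun (72^-1 *: R3_low R) x =
  72^-1 * R3_val (x 0 0) (x 0 1) (x 0 2).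
Proof.
by rewrite -mpoly_fun_R3 /mpoly_fun -mevalB -R3_split mevalZ.
Qed.

Lemma face_approx_error (R : realType) (x : 'rV[R]_2) :
  x 0 0 * x 0 1 * (1 - x 0 0 - x 0 1) - mpoly_fun (72^-1 *: face_low R) x =
  72^-1 * R3_val (x 0 0) (x 0 1) (1 - x 0 0 - x 0 1).
Proof.
rewrite /mpoly_fun /face_low !(mevalD, mevalN, mevalM, rmorphXn, rmorph_nat,
  mevalXU, meval1, mevalB, mevalZ) /R3_val.
by field.
Qed.
(** * Extremality on each domain *)

Lemma mdeg_const (d k : nat) : mdeg [multinom k | i < d] = (d * k)%N.
Proof.
by rewrite mdegE; under eq_bigr do rewrite mnmE; rewrite sum_nat_const card_ord.
Qed.

Lemma simplex3_bound (R : realType) (x : 'rV[R]_3) : @simplex R 3 x ->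
  `|mpoly_fun 'X_[[multinom 1%N | i < 3]] x
    - mpoly_fun (72^-1 *: R3_low R) x| <= 72^-1.
Proof.
case=> x0; rewrite sum_ord3 subr_ge0 => x1.
by rewrite monomial_approx_error scaled_R3_val_le.
Qed.

Lemma simplex3_signature (R : realType) :
  extremal_signature 2 (@simplex R 3) (@barycenter_weight R) (barycenter R 3)
    (fun x => mpoly_fun 'X_[[multinom 1%N | i < 3]] x
              - mpoly_fun (72^-1 *: R3_low R) x) 72^-1.
Proof.
split.
- exact: barycenter_annihilates.
- exact: barycenter_in_simplex.
- exact: barycenter_weight_neq0.
by move=> k; rewrite monomial_approx_error barycenter_sign.
Qed.

Lemma barycenter2E (R : realType) (k : 'I_7) :
  [/\ barycenter R 2 k 0 0 = barycenter R 3 k 0 0,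
      barycenter R 2 k 0 1 = barycenter R 3 k 0 1
    & 1 - barycenter R 2 k 0 0 - barycenter R 2 k 0 1 = barycenter R 3 k 0 2].
Proof.
have := sum_barycenter R k; rewrite sum_ord3 !mxE /= => <-.
by split=> //; ring.
Qed.

Lemma simplex2_signature (R : realType) :
  extremal_signature 2 (@simplex R 2) (@barycenter_weight R) (barycenter R 2)
    (fun x => x 0 0 * x 0 1 * (1 - x 0 0 - x 0 1)
              - mpoly_fun (72^-1 *: face_low R) x) 72^-1.
Proof.
split.
- apply: annihilates_monomials => m; rewrite mdegE sum_ord2 => m2.
  rewrite -[RHS](@barycenter_monomials R (m 0) (m 1) 0) ?addn0 //.
  apply: eq_bigr => k _; rewrite prod_ord2 expr0 mulr1.
  by have [-> -> _] := barycenter2E R k.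
- move=> k; have [e0 e1 e2] := barycenter2E R k; split=> [j|].
    have := barycenter_ge0 R k (widen_ord (isT : (2 <= 3)%N) j).
    by rewrite !mxE.
  by rewrite sum_ord2 opprD addrA e2 barycenter_ge0.
- exact: barycenter_weight_neq0.
move=> k; rewrite face_approx_error; have [-> -> ->] := barycenter2E R k.
exact: barycenter_sign.
Qed.

Lemma simplex2_bound (R : realType) (x : 'rV[R]_2) : @simplex R 2 x ->
  `|x 0 0 * x 0 1 * (1 - x 0 0 - x 0 1)
    - mpoly_fun (72^-1 *: face_low R) x| <= 72^-1.
Proof.
case=> x0; rewrite sum_ord2 opprD addrA => x1.
rewrite face_approx_error scaled_R3_val_le //.
by have -> : x 0 0 + x 0 1 + (1 - x 0 0 - x 0 1) = 1 by ring.
Qed.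

Lemma supnorm_R3 (R : realType) : supnorm (@simplex R 3) (mpoly_fun (R3 R)) = 1.
Proof.
apply: (@supnorm_attained _ _ _ _ _ 0).
- split=> [i|]; first by rewrite mxE.
  by rewrite big1 ?subr0 // => i _; rewrite mxE.
- rewrite mpoly_fun_R3 !mxE.
  have -> : R3_val (0 : R) 0 0 = 1 by rewrite /R3_val; ring.
  exact: normr1.
move=> x [x0]; rewrite sum_ord3 subr_ge0 => x1.
by rewrite mpoly_fun_R3 R3_val_le1.
Qed.

Lemma supnorm_R3_squares (R : realType) :
  supnorm (@unit_ball R 3) (mpoly_fun (R3_squares R)) = 1.
Proof.
apply: (@supnorm_attained _ _ _ _ _ 0).
- by rewrite /unit_ball /= enorm_le1 big1 // => i _; rewrite mxE expr0n.
- rewrite mpoly_fun_squares mpoly_fun_R3 !mxE expr0n.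
  have -> : R3_val (0 : R) 0 0 = 1 by rewrite /R3_val; ring.
  exact: normr1.
move=> x /simplex_squares[x0]; rewrite sum_ord3 subr_ge0 => x1.
by rewrite mpoly_fun_squares mpoly_fun_R3 R3_val_le1.
Qed.

Lemma R3_squares_split (R : realType) :
  72^-1 *: R3_squares R =
  'X_[[multinom 2%N | i < 3]] - squares_mpoly (72^-1 *: R3_low R).
Proof.
rewrite /R3_squares -comp_mpolyZ R3_split comp_mpolyB.
rewrite -!/(squares_mpoly _) squares_mpolyX; congr ('X_[_] - _).
by apply/mnmP => i; rewrite mulmnE !mnmE.
Qed.

Lemma monomial222 (R : realType) :
  (fun x => mpoly_fun 'X_[[multinom 1%N | i < 3]] (squares x)) =
  mpoly_fun ('X_[[multinom 2%N | i < 3]] : {mpoly R[3]}).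
Proof.
apply/funext => x; rewrite !mpoly_funX.
by apply: eq_bigr => j _; rewrite !mnmE mxE.
Qed.

Lemma squares_extremal (R : realType) (Omega : set 'rV[R]_3) :
  @unit_sphere R 3 `<=` Omega -> Omega `<=` @unit_ball R 3 ->
  least_deviation [multinom 2%N | i < 3] Omega (72^-1 *: R3_squares R) /\
  best_approx 5 Omega (fun x => x 0 0 ^+ 2 * x 0 1 ^+ 2 * x 0 2 ^+ 2) = 72^-1.
Proof.
move=> sphO Oball.
have low2 := poly_leZ 72^-1 (R3_low_le R).
have := best_approx_squares sphO Oball low2 (@simplex3_bound R)
  (simplex3_signature R) (@sum_barycenter R).
move=> ext; split.
  rewrite R3_squares_split; apply: (@least_deviation_of _ _ _ _ _ 72^-1).
    by rewrite mdeg_const; apply: (squares_mpoly_le low2).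
  by rewrite mdeg_const -monomial222; apply: ext.
rewrite -[RHS](proj2 ext); congr best_approx.
by rewrite monomial222; apply/funext => x; rewrite mpoly_funX prod_ord3 !mnmE.
Qed.

Lemma simplex3_extremal (R : realType) :
  least_deviation [multinom 1%N | i < 3] (@simplex R 3) (72^-1 *: R3 R) /\
  best_approx 2 (@simplex R 3) (fun x => x 0 0 * x 0 1 * x 0 2) = 72^-1.
Proof.
have low2 := poly_leZ 72^-1 (R3_low_le R).
have ext := best_approx_signature (@simplex_in_cube R 3) low2
  (@simplex3_bound R) (simplex3_signature R).
split.
  rewrite R3_split; apply: (@least_deviation_of _ _ _ _ _ 72^-1).
    by rewrite mdeg_const.
  by rewrite mdeg_const.
rewrite -[RHS](proj2 ext); congr best_approx.
by apply/funext => x; rewrite mpoly_funX prod_ord3 !mnmE.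
Qed.

Lemma simplex2_best_approx (R : realType) :
  best_approx 2 (@simplex R 2)
    (fun x => x 0 0 * x 0 1 * (1 - x 0 0 - x 0 1)) = 72^-1.
Proof.
have low2 := poly_leZ 72^-1 (face_low_le R).
exact: (proj2 (best_approx_signature (@simplex_in_cube R 2) low2
  (@simplex2_bound R) (simplex2_signature R))).
Qed.

Theorem theorem3p1 (R : realType) :
  [/\ least_deviation [multinom 1%N | i < 3] (@simplex R 3)
        (72^-1 *: R3 R),
      best_approx 2 (@simplex R 3)
        (fun x => x 0 0 * x 0 1 * x 0 2) =
      best_approx 2 (@simplex R 2)
        (fun x => x 0 0 * x 0 1 * (1 - x 0 0 - x 0 1)),
      best_approx 2 (@simplex R 2)
        (fun x => x 0 0 * x 0 1 * (1 - x 0 0 - x 0 1)) =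
      72^-1 * supnorm (@simplex R 3) (mpoly_fun (R3 R))
    & 72^-1 * supnorm (@simplex R 3) (mpoly_fun (R3 R)) = 72^-1] /\
  [/\ least_deviation [multinom 2%N | i < 3] (@unit_ball R 3)
        (72^-1 *: R3_squares R) /\
      least_deviation [multinom 2%N | i < 3] (@unit_sphere R 3)
        (72^-1 *: R3_squares R),
      best_approx 5 (@unit_ball R 3)
        (fun x => x 0 0 ^+ 2 * x 0 1 ^+ 2 * x 0 2 ^+ 2) =
      best_approx 5 (@unit_sphere R 3)
        (fun x => x 0 0 ^+ 2 * x 0 1 ^+ 2 * x 0 2 ^+ 2),
      best_approx 5 (@unit_sphere R 3)
        (fun x => x 0 0 ^+ 2 * x 0 1 ^+ 2 * x 0 2 ^+ 2) =
      72^-1 * supnorm (@unit_ball R 3) (mpoly_fun (R3_squares R))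
    & 72^-1 * supnorm (@unit_ball R 3) (mpoly_fun (R3_squares R)) = 72^-1].
Proof.
have [dev3 E3] := simplex3_extremal R.
have sphere_ball : @unit_sphere R 3 `<=` @unit_ball R 3.
  by move=> x; rewrite /unit_sphere /unit_ball /= => ->.
have [devB EB] :=
  squares_extremal sphere_ball (@subset_refl _ (@unit_ball R 3)).
have [devS ES] :=
  squares_extremal (@subset_refl _ (@unit_sphere R 3)) sphere_ball.
rewrite supnorm_R3 supnorm_R3_squares E3 EB ES simplex2_best_approx mulr1.
by split; split.
Qed.
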